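(* Let $a,b\ge1$ be integers, and let $TC(a,a,2b)$ be the number of lozenge tilings of the hexagon $H(a,a,2b)$ that are symmetric with respect to its symmetry axis perpendicular to the sides of length $2b$. Then $$TC(a,a,2b)=\frac{\displaystyle\prod_{j=1}^{a-1}(b+j)^{\min(j,\,a-j)}\ \prod_{j=1}^{a-2}(2b+2j+1)^{\min(j,\,a-1-j)}}{\displaystyle\prod_{j=1}^{a-1}j^{\min(j,\,a-j)}\ \prod_{j=1}^{a-2}(2j+1)^{\min(j,\,a-1-j)}},$$ where empty products equal $1$.
   Context: Work in the regular triangular lattice with unit side. $H(a,b,c)$ is the lattice hexagon with all angles $120^\circ$ and side lengths $a,b,c,a,b,c$ in cyclic order. A lozenge is a unit rhombus that is the union of two unit triangles of the lattice sharing an edge; a lozenge tiling of the hexagon is a covering of it by lozenges contained in it, without gaps or overlaps. (Such symmetric tilings correspond to transposed-complementary plane partitions.) *)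

(* Defs.v *)
From mathcomp Require Import all_boot.

Set Implicit Arguments.
Unset Strict Implicit.
Unset Printing Implicit Defensive.

(** Lattice points are written [x e1 + y e2], where [e1] and [e2] are unit
    vectors at an angle of 60 degrees, so the lattice lines are those of
    directions [e1], [e2] and [e2 - e1].  [(x, y, true)] is the unit triangle
    with vertices [(x,y)], [(x+1,y)], [(x,y+1)]; [(x, y, false)] is the one with
    vertices [(x+1,y)], [(x,y+1)], [(x+1,y+1)].  [triangle m n] is the type of
    unit triangles in the lattice parallelogram [0,m] x [0,n]. *)
Definition triangle (m n : nat) : finType := ('I_m * 'I_n * bool)%type.

Definition vertices (m n : nat) (t : triangle m n) : seq (nat * nat) :=
  let: (x, y, up) := t in
  if up then [:: (x : nat, y : nat); (x.+1, y : nat); (x : nat, y.+1)]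
  else [:: (x.+1, y : nat); (x : nat, y.+1); (x.+1, y.+1)].

Definition share_edge (m n : nat) (t u : triangle m n) : bool :=
  count (mem (vertices u)) (vertices t) == 2.

Definition lozenge (m n : nat) (L : {set triangle m n}) : bool :=
  [exists t, exists u, share_edge t u && (L == [set t; u])].

(** The polygon starting at [(c,0)] with [a] steps [e1], [b] steps [e2], [c]
    steps [e2 - e1], [a] steps [- e1], [b] steps [- e2], [c] steps [e1 - e2]:
    its corners are (c,0), (a+c,0), (a+c,b), (a,b+c), (0,b+c), (0,c). *)
Definition in_hexagon (a b c : nat) (p : nat * nat) : bool :=
  [&& p.1 <= a + c, p.2 <= b + c & c <= p.1 + p.2 <= a + b + c].

(** The hexagon being convex, it contains a triangle iff it contains its
    vertices; it lies in the parallelogram [0,a+c] x [0,b+c]. *)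
Definition hexagon (a b c : nat) : {set triangle (a + c) (b + c)} :=
  [set t | all (in_hexagon a b c) (vertices t)].

Definition lozenge_tiling (m n : nat) (D : {set triangle m n})
    (T : {set {set triangle m n}}) : bool :=
  partition T D && [forall L in T, lozenge L].

(** [(x,y) |-> (y,x)] exchanges [e1] and [e2]: it is the orthogonal reflection
    in the line spanned by [e1 + e2], which is perpendicular to [e2 - e1], the
    direction of the sides of length [c] of [hexagon a a c], and passes through
    the midpoints (c/2,c/2) and (a+c/2,a+c/2) of these two sides. *)
Definition reflect_triangle (n : nat) (t : triangle n n) : triangle n n :=
  let: (x, y, up) := t in (y, x, up).

Definition reflect_lozenge (n : nat) (L : {set triangle n n}) :
    {set triangle n n} :=
  [set reflect_triangle t | t in L].

Definition symmetric_tiling (n : nat) (T : {set {set triangle n n}}) : bool :=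
  [set reflect_lozenge L | L in T] == T.

Definition TC (a c : nat) : nat :=
  #|[set T | lozenge_tiling (hexagon a a c) T && symmetric_tiling T]|.

(* Main.v *)
(** A symmetric tiling contains every lozenge bisected by the axis, so it is
    determined by its part on one side of the axis.  There, the lozenges not
    crossing the lines parallel to the sides of length [2b] link up into [b]
    disjoint paths of [2a] steps from one of these sides to the other: walkers
    at distances 1, 3, ..., 2b-1 (in half units) from the axis at both ends,
    moving by +1 or -1, never meeting and never reaching 0.  Multilinearity of
    the determinant shows that they are counted by
    [det (ballot (2a+2j) (2k+1))], [0 <= j, k < b], since this determinant
    obeys the same recursion in time and vanishes when two walkers meet or one
    reaches the axis.  By the closed form of the ballot numbers, the entries
    are, up to row and column factors, monic polynomials in [- k (k+1)], so the
    determinant is a product of these factors and a Vandermonde determinant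
    that does not depend on [a]; both sides are then compared by induction on
    [a]. *)
Require Import Defs.
From mathcomp Require Import all_boot all_order all_algebra.
From mathcomp Require Import zify ring.

Set Implicit Arguments.
Unset Strict Implicit.
Unset Printing Implicit Defensive.
Import GRing.Theory Num.Theory.

(** * Tilings as matchings of cells *)

Definition cell n (t : triangle n n) : nat * nat := (val t.1.1, val t.1.2).

Definition swap (p : nat * nat) : nat * nat := (p.2, p.1).

(** The values [q] are the cells of the three up triangles sharing an edge with the down triangle of
    cell [p]; the relation is not symmetric. *)
Definition adjacent (p q : nat * nat) : bool :=
  [|| q == p, q == (p.1.+1, p.2) | q == (p.1, p.2.+1)].

Lemma cell_inj n (t u : triangle n n) : cell t = cell u -> t.2 = u.2 -> t = u.
Proof.
case: t u => [[x y] o] [[x' y'] o'] [] /= ex ey eo.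
by rewrite (val_inj ex) (val_inj ey) eo.
Qed.

Lemma exists_triangle n (p : nat * nat) (o : bool) : p.1 < n -> p.2 < n ->
  exists t : triangle n n, cell t = p /\ t.2 = o.
Proof. by case: p => x y /= hx hy; exists (Ordinal hx, Ordinal hy, o). Qed.

Lemma share_edgeE n (t u : triangle n n) : share_edge t u =
  (t.2 != u.2) && (if t.2 then adjacent (cell u) (cell t) else adjacent (cell t) (cell u)).
Proof.
case: t u => [[[x hx] [y hy]] o] [[[x' hx'] [y' hy']] o'].
rewrite /share_edge /adjacent /cell /=.
(* In each coordinate at most one of these equalities holds, which rules out the impossible cases of
   the brute-force count. *)
have excl (i j : nat) : (i == j) + (i == j.+1) + (i.+1 == j) <= 1 by lia.
move: (excl x x') (excl y y').
case: o o' => [] [] /=; rewrite !inE !xpair_eqE !eqSS /=;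
  rewrite ?(eq_sym x' x) ?(eq_sym y' y) ?(eq_sym x' x.+1) ?(eq_sym y' y.+1).
all: by do 3!case: eqP => _; do 3!case: eqP => _.
Qed.

Lemma share_edgeC n (t u : triangle n n) : share_edge t u = share_edge u t.
Proof. by rewrite !share_edgeE eq_sym; case: t u => [? []] [? []]. Qed.

Lemma set2_oriented_inj n (t u t' u' : triangle n n) :
  ~~ t.2 -> u.2 -> ~~ t'.2 -> u'.2 -> [set t; u] = [set t'; u'] -> t = t' /\ u = u'.
Proof.
move=> ht hu ht' hu' e.
have := set21 t u; have := set22 t u; rewrite e => /set2P[eu|eu] /set2P[et|et] //.
- by rewrite -eu hu in ht'.
- by rewrite -eu hu in ht'.
- by rewrite et hu' in ht.
Qed.

Lemma reflect_triangleK n : involutive (@reflect_triangle n).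
Proof. by case=> [[x y] o]. Qed.

Lemma reflect_lozengeK n : involutive (@reflect_lozenge n).
Proof.
move=> L; rewrite /reflect_lozenge -imset_comp (eq_imset (g := id)) ?imset_id //.
exact: reflect_triangleK.
Qed.

Lemma reflect_lozenge2 n (t u : triangle n n) :
  reflect_lozenge [set t; u] = [set reflect_triangle t; reflect_triangle u].
Proof. by rewrite /reflect_lozenge imsetU1 imset_set1. Qed.

Lemma cell_reflect n (t : triangle n n) : cell (reflect_triangle t) = swap (cell t).
Proof. by case: t => [[x y] o]. Qed.

Lemma orient_reflect n (t : triangle n n) : (reflect_triangle t).2 = t.2.
Proof. by case: t => [[x y] o]. Qed.

Section Tilings.
Variables a c : nat.
Local Notation n := (a + c).
Local Notation D := (hexagon a a c).

(** If [s] is the coordinate sum of the cell, the vertices have sums [s] and [s+1] for an up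
    triangle, [s+1] and [s+2] for a down one; hence the shift between [up_cell] and [down_cell]. *)
Definition up_cell (p : nat * nat) : bool :=
  [&& p.1 < n, p.2 < n & c <= p.1 + p.2 < 2 * a + c].

Definition down_cell (p : nat * nat) : bool :=
  [&& p.1 < n, p.2 < n & c <= (p.1 + p.2).+1 < 2 * a + c].

Lemma in_hexagonE (t : triangle n n) :
  (t \in D) = if t.2 then up_cell (cell t) else down_cell (cell t).
Proof.
case: t => [[[x hx] [y hy]] o]; rewrite inE /= /up_cell /down_cell /cell /=.
by case: o; rewrite /= /in_hexagon /=; lia.
Qed.

(** [s] maps the cell of a down triangle to the cell of the up triangle forming
    a lozenge with it. *)
Record matching (s : nat * nat -> nat * nat) : Prop := Matching {
  matching_up : forall p, down_cell p -> up_cell (s p);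
  matching_adj : forall p, down_cell p -> adjacent p (s p);
  matching_inj : forall p q, down_cell p -> down_cell q -> s p = s q -> p = q;
  matching_surj : forall q, up_cell q -> exists2 p, down_cell p & s p = q;
  matching_swap : forall p, down_cell p -> s (swap p) = swap (s p) }.

Definition tiling_of (s : nat * nat -> nat * nat) : {set {set triangle n n}} :=
  [set [set p.1; p.2] | p in [set p : triangle n n * triangle n n |
     [&& p.1 \in D, p.2 \in D, ~~ p.1.2, p.2.2 & cell p.2 == s (cell p.1)]]].

Lemma tiling_ofP s L : reflect
  (exists t u : triangle n n, [/\ t \in D, u \in D, ~~ t.2 & u.2] /\
     cell u = s (cell t) /\ L = [set t; u])
  (L \in tiling_of s).
Proof.
apply: (iffP imsetP) => [[[t u]]|[t [u [[tD uD ht hu] [e ->]]]]].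
  by rewrite inE /= => /and5P[tD uD ht hu /eqP e] ->; exists t, u.
by exists (t, u); rewrite // inE /= tD uD ht hu e eqxx.
Qed.

Lemma mem_tiling_of s (t u : triangle n n) : ~~ t.2 -> u.2 ->
  ([set t; u] \in tiling_of s) = [&& t \in D, u \in D & cell u == s (cell t)].
Proof.
move=> ht hu; apply/tiling_ofP/and3P => [[t' [u' [[tD uD ht' hu'] [e]]]]|[tD uD /eqP e]].
  by move=> /(set2_oriented_inj ht hu ht' hu')[-> ->]; rewrite e.
by exists t, u.
Qed.

Lemma down_triangle p : down_cell p ->
  exists t : triangle n n, [/\ cell t = p, ~~ t.2 & t \in D].
Proof.
move=> pd; have /and3P[p1 p2 _] := pd.
have [t [et ht]] := exists_triangle false p1 p2.
by exists t; rewrite in_hexagonE et ht.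
Qed.

Lemma up_triangle q : up_cell q ->
  exists u : triangle n n, [/\ cell u = q, u.2 & u \in D].
Proof.
move=> qu; have /and3P[q1 q2 _] := qu.
have [u [eu hu]] := exists_triangle true q1 q2.
by exists u; rewrite in_hexagonE eu hu.
Qed.

Lemma down_cellE (t : triangle n n) : t \in D -> ~~ t.2 -> down_cell (cell t).
Proof. by rewrite in_hexagonE => + /negPf ht; rewrite ht. Qed.

Lemma up_cellE (t : triangle n n) : t \in D -> t.2 -> up_cell (cell t).
Proof. by rewrite in_hexagonE => + ht; rewrite ht. Qed.

Lemma tiling_of_inj s s' : matching s -> tiling_of s = tiling_of s' ->
  forall p, down_cell p -> s p = s' p.
Proof.
move=> sm e p pd.
have [t [et ht tD]] := down_triangle pd.
have [u [eu hu uD]] := up_triangle (matching_up sm pd).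
have : [set t; u] \in tiling_of s by rewrite mem_tiling_of // tD uD eu et eqxx.
by rewrite e mem_tiling_of // et eu => /and3P[_ _ /eqP].
Qed.

Lemma reflect_hexagon (t : triangle n n) : (reflect_triangle t \in D) = (t \in D).
Proof.
rewrite !in_hexagonE orient_reflect cell_reflect /up_cell /down_cell /=.
by case: t.2; rewrite andbCA [t.1.2 + _]addnC.
Qed.

Lemma tiling_of_symmetric s : matching s -> symmetric_tiling (tiling_of s).
Proof.
move=> sm.
have refl L : L \in tiling_of s -> reflect_lozenge L \in tiling_of s.
  move=> /tiling_ofP[t [u [[tD uD ht hu] [e ->]]]].
  rewrite reflect_lozenge2 mem_tiling_of ?orient_reflect //.
  rewrite !reflect_hexagon tD uD /= !cell_reflect.
  by rewrite (matching_swap sm) ?e // down_cellE.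
rewrite /symmetric_tiling eqEsubset; apply/andP; split; apply/subsetP => L.
  by move=> /imsetP[L' /refl + ->].
by move=> /refl hL; apply/imsetP; exists (reflect_lozenge L); rewrite ?reflect_lozengeK.
Qed.

(** Adjacency makes each block a lozenge, injectivity makes the blocks disjoint, and surjectivity
    onto the up cells makes them cover the hexagon. *)
Lemma tiling_of_tiling s : matching s -> lozenge_tiling D (tiling_of s).
Proof.
move=> sm; apply/andP; split; last first.
  apply/forall_inP => L /tiling_ofP[t [u [[tD uD ht hu] [e ->]]]].
  apply/existsP; exists t; apply/existsP; exists u; rewrite eqxx andbT.
  rewrite share_edgeE hu (negPf ht) /= e.
  exact: matching_adj (down_cellE tD ht).
apply/and3P; split.
- apply/eqP/setP => t; apply/bigcupP/idP => [[L /tiling_ofP[t' [u' [[tD uD _ _] [_ ->]]]]]|tD].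
    by case/set2P => ->.
  have [ht|ht] := boolP t.2.
    have [p pd ep] := matching_surj sm (up_cellE tD ht).
    have [d [ed hd dD]] := down_triangle pd.
    exists [set d; t]; last exact: set22.
    by rewrite mem_tiling_of // dD tD ed ep eqxx.
  have [u [eu hu uD]] := up_triangle (matching_up sm (down_cellE tD ht)).
  exists [set t; u]; last exact: set21.
  by rewrite mem_tiling_of // tD uD eu eqxx.
- apply/trivIsetP => A B /tiling_ofP[t [u [[tD uD ht hu] [e ->]]]].
  move=> /tiling_ofP[t' [u' [[tD' uD' ht' hu'] [e' ->]]]].
  apply: contraR => /pred0Pn[z] /andP[/set2P zA /set2P zB].
  have [ett|euu] : t = t' \/ u = u'.
  + case: zA zB => -> [] ez; [by left| | |by right].
      by rewrite ez hu' in ht.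
    by rewrite -ez hu in ht'.
  + by rewrite -ett in e' *; rewrite (cell_inj (etrans e (esym e'))) // hu hu'.
  suff -> : t = t' by rewrite euu.
  apply: cell_inj; last by rewrite (negPf ht) (negPf ht').
  by apply: (matching_inj sm); rewrite ?down_cellE // -e -e' euu.
apply/negP => /tiling_ofP[t [u [_ [_ e]]]].
by have := set21 t u; rewrite -e inE.
Qed.

Lemma tiling_partner (T : {set {set triangle n n}}) (t : triangle n n) :
  lozenge_tiling D T -> t \in D ->
  exists u, [/\ u \in D, share_edge t u & [set t; u] \in T].
Proof.
move=> /andP[/and3P[/eqP cT _ _] /forall_inP lT].
rewrite -{1}cT => /bigcupP[L LT tL].
have /existsP[x /existsP[y /andP[exy /eqP eL]]] := lT L LT.
have sD z : z \in L -> z \in D by rewrite -cT => zL; apply/bigcupP; exists L.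
move: tL sD LT; rewrite eL => /set2P[->|->] sD LT.
  by exists y; split=> //; apply/sD/set22.
exists x; split; first exact/sD/set21.
  by rewrite share_edgeC.
by rewrite setUC.
Qed.

Lemma tiling_partner_inj (T : {set {set triangle n n}}) (t u u' : triangle n n) :
  lozenge_tiling D T -> u != t -> [set t; u] \in T -> [set t; u'] \in T -> u = u'.
Proof.
move=> /andP[/and3P[_ /trivIsetP trT _] _] ut uT uT'.
have [e|ne] := eqVneq [set t; u] [set t; u'].
  by have := set22 t u; rewrite e => /set2P[eut|//]; rewrite eut eqxx in ut.
by have /pred0P/(_ t) := trT _ _ uT uT' ne; rewrite /= !inE eqxx.
Qed.

Lemma tiling_matching (T : {set {set triangle n n}}) :
  lozenge_tiling D T -> symmetric_tiling T ->
  exists2 s, matching s & T = tiling_of s.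
Proof.
move=> Tt /eqP Ts.
(* [s] reads the partner of a down triangle off [T]; the default [p] is never reached on a down
   cell. *)
pose s p := if [pick z : triangle n n * triangle n n |
    [&& cell z.1 == p, ~~ z.1.2, z.2.2 & [set z.1; z.2] \in T]] is Some z
  then cell z.2 else p.
have neq (t u : triangle n n) : ~~ t.2 -> u.2 -> u != t.
  by move=> ht hu; apply: contraNneq ht => <-.
have sE (t u : triangle n n) : ~~ t.2 -> u.2 -> [set t; u] \in T -> s (cell t) = cell u.
  move=> ht hu tuT; rewrite /s; case: pickP => [[t' u'] /=|/(_ (t, u))]; last first.
    by rewrite eqxx ht hu tuT.
  move=> /and4P[/eqP et ht' hu' tuT'].
  have ett : t' = t by apply: cell_inj; rewrite // (negPf ht) (negPf ht').
  by rewrite ett in tuT'; rewrite (tiling_partner_inj Tt (neq _ _ ht hu) tuT tuT').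
have partner p : down_cell p -> exists t u : triangle n n,
    [/\ cell t = p, ~~ t.2, u.2, u \in D & t \in D] /\
    [/\ s p = cell u, adjacent p (cell u) & [set t; u] \in T].
  move=> /down_triangle[t [et ht tD]].
  have [u [uD tu tuT]] := tiling_partner Tt tD.
  move: tu; rewrite share_edgeE (negPf ht) /= -{1}et.
  case hu: u.2 => //= adj; exists t, u; do 2!split=> //.
    by rewrite -et (sE t u).
  by rewrite -et.
have sm : matching s.
  split.
  - by move=> p /partner[t [u [[_ _ hu uD _] [-> _ _]]]]; apply: up_cellE.
  - by move=> p /partner[t [u [_ [-> ]]]].
  - move=> p q /partner[t [u [[<- ht hu uD tD] [-> _ tuT]]]].
    move=> /partner[t' [u' [[<- ht' hu' uD' tD'] [-> _ tuT']]]] euu.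
    have {}euu : u = u' by apply: cell_inj; rewrite // hu hu'.
    rewrite -{}euu setUC in tuT'; rewrite setUC in tuT.
    rewrite (tiling_partner_inj Tt _ tuT tuT') // eq_sym; exact: neq.
  - move=> q /up_triangle[u [eu hu uD]].
    have [t [tD ut utT]] := tiling_partner Tt uD.
    have ht : ~~ t.2 by move: ut; rewrite share_edgeE hu; case: t.2.
    exists (cell t); first exact: down_cellE.
    by rewrite (sE t u) // setUC.
  - move=> p /partner[t [u [[<- ht hu uD tD] [-> _ tuT]]]].
    rewrite -!cell_reflect; apply: sE; rewrite ?orient_reflect //.
    by rewrite -reflect_lozenge2 -Ts; apply/imsetP; exists [set t; u].
exists s => //; apply/setP => L; apply/idP/tiling_ofP => [LT|].
  have /andP[/and3P[/eqP cT _ _] /forall_inP lT] := Tt.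
  have /existsP[x /existsP[y /andP[exy /eqP eL]]] := lT L LT.
  have sD z : z \in L -> z \in D by rewrite -cT => zL; apply/bigcupP; exists L.
  rewrite eL in LT sD *; have xD := sD x (set21 _ _); have yD := sD y (set22 _ _).
  move: exy; rewrite share_edgeE => /andP[+ _].
  case hx: x.2; case hy: y.2 => // _.
    by exists y, x; rewrite setUC hx hy (sE y x) ?hx ?hy // setUC.
  by exists x, y; rewrite hx hy (sE x y) ?hx ?hy.
move=> [t [u [[tD uD ht hu] [e ->]]]].
have [t' [u' [[et' ht' hu' _ _] [e' _ tuT]]]] := partner _ (down_cellE tD ht).
have <- : t' = t by apply: cell_inj; rewrite // (negPf ht) (negPf ht').
by have -> : u = u' by apply: cell_inj; rewrite ?hu ?hu' // e e'.
Qed.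
End Tilings.

(** * Path families *)

Section Paths.
Variables a b : nat.
Local Notation down := (down_cell a (2 * b)).
Local Notation up := (up_cell a (2 * b)).

(** [P i k] is the cell of path [k] after [i] steps, on the side [x < y] of the
    axis; outer paths have larger [k]. *)
Record path_family (P : nat -> 'I_b -> nat * nat) : Prop := PathFamily {
  path_start : forall k : 'I_b, P 0 k = (b - k.+1, b + k);
  path_step : forall i k, i < 2 * a ->
    P i.+1 k = ((P i k).1.+1, (P i k).2) \/ P i.+1 k = ((P i k).1, (P i k).2.+1);
  path_above : forall i k, i <= 2 * a -> (P i k).1 < (P i k).2;
  path_lt : forall i (k l : 'I_b), i <= 2 * a -> k < l -> (P i l).1 < (P i k).1;
  path_end : forall k : 'I_b, P (2 * a) k = (a + (b - k.+1), a + b + k) }.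

Section MatchingOfPaths.
Variable P : nat -> 'I_b -> nat * nat.
Hypothesis PP : path_family P.

(** Each step raises the coordinate sum by one, from [2b-1] on. So a cell determines its time, which
    [path_inj] and the decoding in [half_match] rely on. *)
Lemma path_sum i k : i <= 2 * a -> ((P i k).1 + (P i k).2).+1 = 2 * b + i.
Proof.
elim: i => [|i IHi] lei; first by rewrite (path_start PP) /=; have := ltn_ord k; lia.
have := IHi (ltnW lei); case: (path_step PP k lei) => -> /=; lia.
Qed.

Lemma path_inj i j k l : i <= 2 * a -> j <= 2 * a -> P i k = P j l -> i = j /\ k = l.
Proof.
move=> lei lej e.
have eij : i = j by have := path_sum k lei; have := path_sum l lej; rewrite e; lia.
split=> //; move: e; rewrite -eij => e; apply: val_inj; case: (ltngtP k l) => // lt.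
  by have := path_lt PP lei lt; rewrite e ltnn.
by have := path_lt PP lei lt; rewrite e ltnn.
Qed.

(** The second coordinate never decreases along a path, so its final value bounds it; the induction
    is on the number [m] of remaining steps. *)
Lemma path_bound i k : i <= 2 * a -> (P i k).2 < a + 2 * b.
Proof.
move=> lei; have [m em] : exists m, i + m = 2 * a by exists (2 * a - i); lia.
elim: m i lei em => [|m IHm] i lei em.
  by rewrite (_ : i = 2 * a) ?(path_end PP) /=; have := ltn_ord k; lia.
have lti : i < 2 * a by lia.
by have := IHm i.+1 lti ltac:(lia); case: (path_step PP k lti) => -> /=; lia.
Qed.

Lemma path_down i k : i < 2 * a -> down (P i k).
Proof.
move=> lti; have lei := ltnW lti; apply/and3P.
have := path_sum k lei; have := path_bound k lei; have := path_above PP k lei.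
by split; lia.
Qed.

Lemma path_up i k : 0 < i <= 2 * a -> up (P i k).
Proof.
move=> /andP[i0 lei]; apply/and3P.
have := path_sum k lei; have := path_bound k lei; have := path_above PP k lei.
by split; lia.
Qed.
End MatchingOfPaths.

(** * From path families to symmetric matchings *)

Section HalfMatching.
Variable P : nat -> 'I_b -> nat * nat.

(** A cell [(x, y)] lies on the [i]-th line parallel to the sides of length [2b]
    iff [x + y + 1 = 2b + i]; cells off the paths are lozenges by themselves. *)
Definition half_match (p : nat * nat) : nat * nat :=
  let i := (p.1 + p.2).+1 - 2 * b in
  if [pick k | P i k == p] is Some k then P i.+1 k else p.

(** The far side of the axis is filled by reflection; a cell on the diagonal is a lozenge bisected
    by the axis. *)
Definition match_of (p : nat * nat) : nat * nat :=
  if p.1 < p.2 then half_match p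
  else if p.2 < p.1 then swap (half_match (swap p)) else p.

Hypothesis PP : path_family P.

Lemma half_match_path i k : i <= 2 * a -> half_match (P i k) = P i.+1 k.
Proof.
move=> lei; rewrite /half_match.
have -> : ((P i k).1 + (P i k).2).+1 - 2 * b = i by have := path_sum PP k lei; lia.
case: pickP => [l /eqP e|/(_ k)]; last by rewrite eqxx.
by have [_ ->] := path_inj PP lei lei e.
Qed.

Lemma half_match_off p : (forall i k, i <= 2 * a -> P i k <> p) -> down p -> half_match p = p.
Proof.
move=> off /and3P[_ _ pd]; rewrite /half_match; case: pickP => // k /eqP e.
by case: (@off ((p.1 + p.2).+1 - 2 * b) k ltac:(lia)).
Qed.

Lemma on_pathP p : (exists i k, i <= 2 * a /\ P i k = p) \/ (forall i k, i <= 2 * a -> P i k <> p).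
Proof.
case: (boolP [exists i : 'I_(2 * a).+1, exists k, P i k == p]) => [on|off]; [left|right].
  case/existsP: on => i /existsP[k /eqP e]; exists i, k; split=> //; exact: leq_ord.
move=> i k lei e; move/existsP: off; apply.
by exists (Ordinal (lei : i < (2 * a).+1)); apply/existsP; exists k; apply/eqP.
Qed.

(** The starting cells fill this side of the first line, which carries down cells but no up cells;
    [last_on_path] treats the last line, which carries only up cells. Hence off the paths, on this
    side, down cells and up cells are the same. *)
Lemma first_on_path p : p.1 < p.2 -> (p.1 + p.2).+1 = 2 * b -> exists k, P 0 k = p.
Proof.
case: p => x y /= ltxy e; have ltk : y - b < b by lia.
by exists (Ordinal ltk); rewrite (path_start PP) /=; congr pair; lia.
Qed.

Lemma last_on_path p : p.1 < p.2 -> p.2 < a + 2 * b -> (p.1 + p.2).+1 = 2 * b + 2 * a ->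
  exists k, P (2 * a) k = p.
Proof.
case: p => x y /= ltxy lty e; have ltk : y - (a + b) < b by lia.
by exists (Ordinal ltk); rewrite (path_end PP) /=; congr pair; lia.
Qed.

Lemma half_match_cases p : down p -> p.1 < p.2 ->
  (exists i k, [/\ i < 2 * a, P i k = p & half_match p = P i.+1 k]) \/
  [/\ forall i k, i <= 2 * a -> P i k <> p, up p & half_match p = p].
Proof.
move=> pd ltp; case: (on_pathP p) => [[i [k [lei e]]]|off]; [left|right].
  exists i, k; rewrite -e half_match_path //; split=> //.
  by move/and3P: pd => [_ _]; have := path_sum PP k lei; rewrite e; lia.
split=> //; last exact: half_match_off.
move: pd => /and3P[p1 p2 pd]; apply/and3P; split=> //.
have ne : (p.1 + p.2).+1 != 2 * b.
  by apply/eqP => /(first_on_path ltp)[k]; apply: off.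
lia.
Qed.

Lemma half_match_up p : down p -> p.1 < p.2 -> up (half_match p).
Proof.
move=> pd /(half_match_cases pd)[[i [k [lti _ ->]]]|[_ pu -> //]].
by rewrite path_up // lti.
Qed.

Lemma half_match_above p : down p -> p.1 < p.2 -> (half_match p).1 < (half_match p).2.
Proof.
move=> pd ltp; case: (half_match_cases pd ltp) => [[i [k [lti _ ->]]]|[_ _ -> //]].
exact: path_above.
Qed.

Lemma half_match_adj p : down p -> p.1 < p.2 -> adjacent p (half_match p).
Proof.
move=> pd /(half_match_cases pd)[[i [k [lti <- ->]]]|[_ _ ->]]; last by rewrite /adjacent eqxx.
by rewrite /adjacent; case: (path_step PP k lti) => ->; rewrite eqxx ?orbT.
Qed.

Lemma half_match_inj p q : down p -> p.1 < p.2 -> down q -> q.1 < q.2 ->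
  half_match p = half_match q -> p = q.
Proof.
move=> pd ltp qd ltq.
case: (half_match_cases pd ltp) => [[i [k [lti ep ->]]]|[offp _ ->]];
  case: (half_match_cases qd ltq) => [[j [l [ltj eq ->]]]|[offq _ ->]] //.
- by move=> /(path_inj PP lti ltj)[[eij] ekl]; rewrite -ep -eq eij ekl.
- by move=> e; case: (offq _ k lti).
- by move=> /esym e; case: (offp _ l ltj).
Qed.

Lemma half_match_surj q : up q -> q.1 < q.2 ->
  exists p, [/\ down p, p.1 < p.2 & half_match p = q].
Proof.
move=> qu ltq; case: (on_pathP q) => [[i [k [lei e]]]|off].
  have i0 : 0 < i.
    by have := path_sum PP k lei; rewrite e; move/and3P: qu => [_ _]; lia.
  case: i i0 lei e => // i _ lti e; exists (P i k); rewrite half_match_path ?(ltnW lti) //.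
  by split=> //; [exact: path_down|apply: path_above => //; exact: ltnW].
have qd : down q.
  have /and3P[q1 q2 qs] := qu; apply/and3P; split=> //.
  have ne : (q.1 + q.2).+1 != 2 * b + 2 * a.
    by apply/eqP => /(last_on_path ltq q2)[k]; apply: off.
  lia.
by exists q; split=> //; apply: half_match_off.
Qed.

Lemma swapK : involutive swap. Proof. by case. Qed.

Lemma down_swap p : down (swap p) = down p.
Proof. by rewrite /down_cell /= andbCA [p.2 + _]addnC. Qed.

Lemma up_swap p : up (swap p) = up p.
Proof. by rewrite /up_cell /= andbCA [p.2 + _]addnC. Qed.

Lemma adjacent_swap p q : adjacent (swap p) (swap q) = adjacent p q.
Proof.
case: p q => [x y] [x' y']; rewrite /adjacent /= !xpair_eqE /=.
by rewrite (andbC (y' == y)) (andbC (y' == _.+1)) (andbC (y' == y)) [X in _ || X]orbC.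
Qed.

Lemma match_of_above p : p.1 < p.2 -> match_of p = half_match p.
Proof. by rewrite /match_of => ->. Qed.

Lemma match_of_swap p : match_of (swap p) = swap (match_of p).
Proof.
case: p => x y; rewrite /match_of /=; case: (ltngtP x y) => // _.
by rewrite swapK.
Qed.

Lemma match_of_diag x : match_of (x, x) = (x, x).
Proof. by rewrite /match_of /= ltnn. Qed.

Lemma above_ind (Q : nat * nat -> Prop) :
  (forall p, Q (swap p) -> Q p) -> (forall p, p.1 < p.2 -> Q p) ->
  (forall x, Q (x, x)) -> forall p, Q p.
Proof.
move=> Qs Qa Qd [x y]; case: (ltngtP x y) => [lt|lt|<- //]; first exact: Qa.
by apply/Qs/Qa.
Qed.

Lemma match_of_matching : matching a (2 * b) match_of.
Proof.
split.
- apply: above_ind => [p|p ltp pd|x].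
  + by rewrite down_swap match_of_swap up_swap.
  + by rewrite match_of_above // half_match_up.
  rewrite match_of_diag => /and3P[/= x1 _ xs]; rewrite /up_cell /= x1 /=; lia.
- apply: above_ind => [p|p ltp pd|x].
  + by rewrite down_swap match_of_swap adjacent_swap.
  + by rewrite match_of_above // half_match_adj.
  by rewrite match_of_diag /adjacent eqxx.
(* [match_of] preserves the side of the axis, so equal images force [p] and [q] onto the same side,
   where [half_match_inj] applies directly or after a swap. *)
- have side p : down p -> p.1 < p.2 -> (match_of p).1 < (match_of p).2.
    by move=> pd ltp; rewrite match_of_above // half_match_above.
  have side' p : down p -> p.2 < p.1 -> (match_of p).2 < (match_of p).1.
    by move=> pd ltp; have := side (swap p); rewrite down_swap match_of_swap; apply.
  have diag p : p.1 = p.2 -> match_of p = p by case: p => x y /= ->; exact: match_of_diag.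
  move=> p q pd qd e.
  case: (ltngtP p.1 p.2) => hp; case: (ltngtP q.1 q.2) => hq.
  + by move: e; rewrite !match_of_above //; exact: half_match_inj.
  + by have := side _ pd hp; have := side' _ qd hq; rewrite e; lia.
  + by have := side _ pd hp; rewrite e diag // hq ltnn.
  + by have := side' _ pd hp; have := side _ qd hq; rewrite e; lia.
  + apply: (can_inj swapK); move: e => /(congr1 swap).
    rewrite -!match_of_swap !match_of_above //; apply: half_match_inj; by rewrite ?down_swap.
  + by have := side' _ pd hp; rewrite e diag // hq ltnn.
  + by have := side _ qd hq; rewrite -e diag // hp ltnn.
  + by have := side' _ qd hq; rewrite -e diag // hp ltnn.
  + by move: e; rewrite !diag.
- apply: above_ind => [q surj|q ltq qu|x].
  + rewrite -up_swap => /surj[p pd e]; exists (swap p); first by rewrite down_swap.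
    by rewrite match_of_swap e swapK.
  + have [p [pd ltp e]] := half_match_surj qu ltq.
    by exists p; rewrite // match_of_above.
  move=> /and3P[/= x1 _ xs]; exists (x, x); last exact: match_of_diag.
  by rewrite /down_cell /= x1 /=; lia.
by move=> p _; exact: match_of_swap.
Qed.
End HalfMatching.
End Paths.

(** A strictly increasing function dominates the identity; applying this to [f] and to
    [b-1-f(b-1-k)] gives both inequalities. *)
Lemma increasing_ord_id b (f : 'I_b -> nat) :
  (forall k l : 'I_b, k < l -> f k < f l) -> (forall k, f k < b) -> forall k, f k = k :> nat.
Proof.
have ge (g : 'I_b -> nat) : (forall k l : 'I_b, k < l -> g k < g l) -> forall k : 'I_b, k <= g k.
  move=> ginc [k hk]; elim: k hk => // k IHk hk /=.
  by have := IHk (ltnW hk); have := ginc (Ordinal (ltnW hk)) (Ordinal hk) (leqnn _); rewrite /=; lia.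
move=> finc flt k; apply/eqP; rewrite eqn_leq ge // andbT.
have := @ge (fun i => b.-1 - f (rev_ord i)).
have inc (i j : 'I_b) : i < j -> b.-1 - f (rev_ord i) < b.-1 - f (rev_ord j).
  move=> ij; have := finc (rev_ord j) (rev_ord i).
  have := flt (rev_ord i); have := flt (rev_ord j); rewrite /=; have := ltn_ord j; lia.
move=> /(_ inc (rev_ord k)); rewrite rev_ordK /=.
by have := flt k; have := ltn_ord k; lia.
Qed.

(** * From symmetric matchings to path families *)

Section PathsOfMatching.
Variables a b : nat.
Hypothesis a_gt0 : 0 < a.
Local Notation down := (down_cell a (2 * b)).
Local Notation up := (up_cell a (2 * b)).
Variable s : nat * nat -> nat * nat.
Hypothesis sm : matching a (2 * b) s.

Definition trace i (k : 'I_b) : nat * nat := iter i s (b - k.+1, b + k).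

Lemma traceS i k : trace i.+1 k = s (trace i k).
Proof. by []. Qed.

(** A symmetric matching cannot send [p] onto the axis, as it would also send
    [swap p] there. *)
Lemma matching_off_diag p : down p -> p.1 < p.2 -> (s p).1 < (s p).2.
Proof.
move=> pd ltp; have nd : (s p).1 != (s p).2.
  apply/eqP => e; have spp : s (swap p) = s p.
    by rewrite (matching_swap sm) //; case: (s p) e => x y /= ->.
  have := matching_inj sm _ pd spp; rewrite down_swap => /(_ pd).
  by case: p ltp {pd e spp} => x y /= ltp [e _]; rewrite e ltnn in ltp.
have := matching_adj sm pd; case: p (s p) ltp nd {pd} => x y [x' y'] /= ltp nd.
by rewrite /adjacent !xpair_eqE /=; lia.
Qed.

(** A trace cannot stall before the last line: its first cell is not an up cell, so not its own
    image, and by injectivity a later fixed cell would make the previous one fixed. Every step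
    therefore reaches the next line. *)
Lemma traceP i : i <= 2 * a -> forall k,
  [/\ ((trace i k).1 + (trace i k).2).+1 = 2 * b + i, (trace i k).1 < (trace i k).2,
      i < 2 * a -> down (trace i k), 0 < i -> up (trace i k) &
      i < 2 * a -> s (trace i k) <> trace i k].
Proof.
elim: i => [|i IHi] lei k.
  have ltk := ltn_ord k.
  have td : down (trace 0 k) by rewrite /trace /down_cell /=; lia.
  split=> //; [by rewrite /trace /=; lia|by rewrite /trace /=; lia|].
  by move=> _ e; have := matching_up sm td; rewrite e /trace => /and3P[_ _] /=; lia.
have [ts ta td _ tm] := IHi (ltnW lei) k.
have {}td := td lei; have {}tm := tm lei.
have sa := matching_off_diag td ta.
have su := matching_up sm td.
have ss : ((s (trace i k)).1 + (s (trace i k)).2).+1 = 2 * b + i.+1.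
  have := matching_adj sm td; rewrite /adjacent => /or3P[] /eqP e //; rewrite e /=; lia.
have sd : i.+1 < 2 * a -> down (s (trace i k)).
  by move=> lti; have /and3P[s1 s2 s3] := su; apply/and3P; split=> //; lia.
rewrite traceS; split=> // lti e.
by have := matching_inj sm (sd lti) td e; move/tm.
Qed.

(** The preimage [q] of [p] is [p] itself or lies on the previous line. In the latter case, [q] on a
    trace would put [p] on it too, and [q] off the traces would be fixed by induction, so could not
    map to [p]. *)
Lemma trace_off i p : i <= 2 * a -> down p -> p.1 < p.2 -> (p.1 + p.2).+1 = 2 * b + i ->
  (forall k, trace i k <> p) -> s p = p.
Proof.
elim: i p => [|i IHi] p lei pd ltp ps off.
  have ltk : p.2 - b < b by lia.
  case: (off (Ordinal ltk)); rewrite /trace /=; case: p ltp ps ltk {off pd} => x y /= *.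
  by congr pair; lia.
have pu : up p by have /and3P[p1 p2 p3] := pd; apply/and3P; split=> //; lia.
have [q qd e] := matching_surj sm pu.
have [//|[ltq qs]] : s p = p \/ q.1 < q.2 /\ (q.1 + q.2).+1 = 2 * b + i.
  have := matching_adj sm qd; rewrite e /adjacent => /or3P[/eqP epq|/eqP h|/eqP h].
  - by left; move: e; rewrite -epq.
  - by right; move: ltp ps; rewrite h /=; lia.
  right; move: ltp ps; rewrite h /= => ltp ps; split; last by lia.
  (* A preimage [q] on the axis is excluded: by symmetry its image [p] would be on the axis as
     well. *)
  rewrite ltn_neqAle; apply/andP; split; last by lia.
  apply/eqP => eqq; have eswap : swap q = q by case: (q) eqq => x y /= ->.
  by have := matching_swap sm qd; rewrite eswap e h => -[]; lia.
have [/existsP[k /eqP ek]|/existsPn offq] := boolP [exists k, trace i k == q].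
  by case: (off k); rewrite traceS ek.
have sq : s q = q by apply: (IHi q (ltnW lei)) => // k ek; move: (offq k); rewrite ek eqxx.
by move: ps; rewrite -e sq qs; lia.
Qed.

Lemma trace_step i k : i < 2 * a ->
  trace i.+1 k = ((trace i k).1.+1, (trace i k).2) \/
  trace i.+1 k = ((trace i k).1, (trace i k).2.+1).
Proof.
move=> lti; have [_ _ /(_ lti) td _ /(_ lti) tm] := traceP (ltnW lti) k.
rewrite traceS.
have := matching_adj sm td; rewrite /adjacent => /or3P[/eqP //|/eqP->|/eqP->].
  by left.
by right.
Qed.

(** First coordinates grow by at most one per step, so the order could only be lost through a
    collision, which injectivity of [s] forbids. *)
Lemma trace_lt i (k l : 'I_b) : i <= 2 * a -> k < l -> (trace i l).1 < (trace i k).1.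
Proof.
elim: i => [|i IHi] lei ltkl; first by rewrite /trace /=; have := ltn_ord l; lia.
have {IHi} lt := IHi (ltnW lei) ltkl.
have [sk _ /(_ lei) dk _ _] := traceP (ltnW lei) k.
have [sl _ /(_ lei) dl _ _] := traceP (ltnW lei) l.
have [sk' _ _ _ _] := traceP lei k; have [sl' _ _ _ _] := traceP lei l.
have ne : (trace i.+1 l).1 != (trace i.+1 k).1.
  apply/eqP => e1; have e2 : trace i.+1 l = trace i.+1 k.
    case: (trace i.+1 l) (trace i.+1 k) e1 sk' sl' => x y [x' y'] /= *; congr pair; lia.
  by have := matching_inj sm dl dk e2 => e; rewrite e ltnn in lt.
rewrite ltn_neqAle ne andTb.
by case: (trace_step k lei) (trace_step l lei) => -> [] -> /=; lia.
Qed.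

(** The final second coordinates increase strictly with the index inside an interval of [b]
    integers, so they fill it in order. *)
Lemma trace_end k : trace (2 * a) k = (a + (b - k.+1), a + b + k).
Proof.
have tP l := traceP (leqnn (2 * a)) l.
have ge l : a + b <= (trace (2 * a) l).2 < a + 2 * b.
  have [ts ta _ tu _] := tP l; have /and3P[_ t2 _] := tu ltac:(lia).
  by rewrite t2 andbT; lia.
have := @increasing_ord_id b (fun l => (trace (2 * a) l).2 - (a + b)).
have inc (i j : 'I_b) : i < j ->
    (trace (2 * a) i).2 - (a + b) < (trace (2 * a) j).2 - (a + b).
  move=> /(trace_lt (leqnn _)); have := ge i; have := ge j.
  have [tsi _ _ _ _] := tP i; have [tsj _ _ _ _] := tP j; lia.
have lt i : (trace (2 * a) i).2 - (a + b) < b by have := ge i; lia.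
move=> /(_ inc lt k); have [ts _ _ _ _] := tP k; have := ge k; have := ltn_ord k.
by case: (trace (2 * a) k) ts => x y /= *; congr pair; lia.
Qed.

Lemma trace_family : path_family a trace.
Proof.
split=> //.
- exact: trace_step.
- by move=> i k lei; have [] := traceP lei k.
- exact: trace_lt.
exact: trace_end.
Qed.

Lemma match_of_trace p : down p -> s p = match_of trace p.
Proof.
move: p; have half p : down p -> p.1 < p.2 -> s p = half_match trace p.
  move=> pd ltp; case: (on_pathP a trace p) => [[i [k [lei <-]]]|off].
    by rewrite (half_match_path trace_family).
  rewrite (half_match_off off) //; apply: (@trace_off ((p.1 + p.2).+1 - 2 * b)) => //.
  - by move/and3P: pd => [_ _]; lia.
  - by move/and3P: pd => [_ _]; lia.
  by move=> k; apply: off; move/and3P: pd => [_ _]; lia.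
apply: above_ind => [p IHp pd|p ltp pd|x pd].
- have := IHp; rewrite down_swap match_of_swap (matching_swap sm) // => /(_ pd).
  exact: (can_inj swapK).
- by rewrite match_of_above // half.
rewrite match_of_diag.
have /and3P[/= x1 _ xs] := pd.
(* By parity, [2b <= 2x+1] gives [2b <= 2x], so [(x, x)] is also an up cell. Its preimage lies on
   the diagonal by symmetry and injectivity, and adjacency then leaves only [(x, x)]. *)
have xu : up (x, x) by rewrite /up_cell /= x1 /=; lia.
have [q qd e] := matching_surj sm xu.
suff eqx : q = (x, x) by move: e; rewrite eqx.
have eq12 : q.1 = q.2.
  have es : s (swap q) = s q by rewrite (matching_swap sm) // e.
  by have := matching_inj sm _ qd es; rewrite down_swap => /(_ qd); case: (q) => i j [].
have := matching_adj sm qd; rewrite e; case: q eq12 {qd e} => i j /= -> ; rewrite /adjacent !xpair_eqE /=.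
by move=> h; congr pair; lia.
Qed.
End PathsOfMatching.

(** * Walks *)

Section Walks.
Variable b : nat.
Implicit Types (w : {ffun 'I_b -> nat}) (e : {ffun 'I_b -> bool}).

(** [w k] is the distance of walker [k] to the axis; [e k] says that it steps
    towards the axis. *)
Definition stride w e : {ffun 'I_b -> nat} :=
  [ffun k => if e k then (w k).-1 else (w k).+1].

Definition admissible w : bool :=
  [forall k, 0 < w k] && [forall k : 'I_b, forall l : 'I_b, (k < l) ==> (w k < w l)].

Definition packed : {ffun 'I_b -> nat} := [ffun k : 'I_b => (2 * k).+1].

Fixpoint walk w (s : seq {ffun 'I_b -> bool}) : bool :=
  admissible w && if s is e :: s' then walk (stride w e) s' else w == packed.

Lemma admissibleP w :
  reflect ((forall k, 0 < w k) /\ (forall k l : 'I_b, k < l -> w k < w l))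
          (admissible w).
Proof.
apply: (iffP andP) => [[/forallP w0 /forallP wlt]|[w0 wlt]]; split=> //.
- by move=> k l ltkl; have /forallP/(_ l)/implyP := wlt k; apply.
- exact/forallP.
by apply/forallP => k; apply/forallP => l; apply/implyP => /wlt.
Qed.

End Walks.

(** * Path families encoded as step sequences *)

Section Sequences.
Variable b : nat.
Local Notation step := {ffun 'I_b -> bool}.
Local Notation position := {ffun 'I_b -> nat * nat}.

Definition advance (p : position) (e : step) : position :=
  [ffun k => if e k then ((p k).1.+1, (p k).2) else ((p k).1, (p k).2.+1)].

Definition height (p : position) : {ffun 'I_b -> nat} := [ffun k => (p k).2 - (p k).1].

(** Positive heights keep the truncated subtractions in [height] and [stride] exact for one more
    step. *)
Lemma height_advance p e : admissible (height p) ->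
  height (advance p e) = stride (height p) e.
Proof.
move=> /admissibleP[p0 _]; apply/ffunP => k; have := p0 k.
by rewrite !ffunE; case: (e k) => /=; lia.
Qed.

Lemma walk_height p (t : seq step) : reflect
  ((forall i, i <= size t -> admissible (height (foldl advance p (take i t)))) /\
   height (foldl advance p t) = packed b)
  (walk (height p) t).
Proof.
elim: t p => [|e t IHt] p /=.
  apply: (iffP andP) => [[pa /eqP pp]|[pa pp]].
  2: by split; [exact: (pa 0 isT)|apply/eqP].
  by split=> // i; rewrite leqn0 => /eqP->.
have [pa|pna] := boolP (admissible (height p)); last first.
  by constructor => -[/(_ 0 isT)]; rewrite (negPf pna).
rewrite -height_advance //; apply: (iffP (IHt _)) => -[ta te]; split=> //.
  by case=> [|i] //=; exact: ta.
by move=> i; exact: (ta i.+1).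
Qed.

Definition start : position := [ffun k : 'I_b => (b - k.+1, b + k)].

Definition path_of (t : seq step) (i : nat) : position := foldl advance start (take i t).

Lemma path_ofS t i k : i < size t -> path_of t i.+1 k =
  if nth [ffun=> false] t i k then ((path_of t i k).1.+1, (path_of t i k).2)
  else ((path_of t i k).1, (path_of t i k).2.+1).
Proof.
by move=> lti; rewrite /path_of (take_nth [ffun=> false]) // foldl_rcons ffunE.
Qed.

Lemma height_start : height start = packed b.
Proof. by apply/ffunP => k; rewrite !ffunE /=; have := ltn_ord k; lia. Qed.

(** The coordinate sum is fixed at each time, so heights determine cells: positivity amounts to
    [path_above], strict order to [path_lt], and the packed final heights to [path_end]. *)
Lemma walk_path_family a (t : (2 * a).-tuple step) :
  walk (packed b) t <-> path_family a (path_of t).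
Proof.
have sum i k : i <= 2 * a -> ((path_of t i k).1 + (path_of t i k).2).+1 = 2 * b + i.
  elim: i => [|i IHi] lei; first by rewrite /path_of take0 ffunE /=; have := ltn_ord k; lia.
  have := IHi (ltnW lei); rewrite path_ofS ?size_tuple //; case: ifP => _ /=; lia.
rewrite -height_start; split=> [/walk_height|fam].
  rewrite size_tuple -[X in height (foldl _ _ X)](@take_oversize _ (2 * a)) ?size_tuple //.
  move=> [adm fin]; split=> [k|i k lti|i k lei|i k l lei ltkl|k].
  - by rewrite /path_of take0 ffunE.
  - by rewrite path_ofS ?size_tuple //; case: ifP; [left|right].
  - by have /admissibleP[/(_ k) + _] := adm i lei; rewrite ffunE /path_of; lia.
  - have /admissibleP[/(_ l) + /(_ k l ltkl)] := adm i lei; rewrite !ffunE.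
    by have := sum i k lei; have := sum i l lei; rewrite /path_of; lia.
  move/ffunP: fin => /(_ k); rewrite !ffunE -/(path_of t (2 * a)).
  have := sum _ k (leqnn _); case: (path_of _ _ k) => x y /= *.
by have := ltn_ord k; move=> *; congr pair; lia.
apply/walk_height; rewrite size_tuple; split=> [i lei|].
  rewrite -/(path_of t i); apply/admissibleP; split=> [k|k l ltkl].
    by rewrite ffunE; have := path_above fam k lei; lia.
  rewrite !ffunE; have := path_lt fam lei ltkl; have := path_above fam k lei.
  by have := sum i k lei; have := sum i l lei; lia.
rewrite -[X in foldl _ _ X](@take_oversize _ (2 * a)) ?size_tuple //.
by apply/ffunP => k; rewrite !ffunE -/(path_of t (2 * a)) (path_end fam) /=; have := ltn_ord k; lia.
Qed.

Lemma exists_path_of a P : path_family a P ->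
  exists t : (2 * a).-tuple step, forall i k, i <= 2 * a -> path_of t i k = P i k.
Proof.
move=> fam.
exists [tuple [ffun k => (P i.+1 k).1 != (P i k).1] | i < 2 * a].
elim=> [|i IHi] k lei; first by rewrite /path_of take0 ffunE (path_start fam).
rewrite path_ofS ?size_tuple // IHi ?(ltnW lei) //.
rewrite (_ : nth _ _ i = [ffun k => (P i.+1 k).1 != (P i k).1]).
  rewrite ffunE; case: (path_step fam k lei) => -> /=; last by rewrite eqxx.
  by rewrite eqn_leq ltnn.
by rewrite -[i]/(val (Ordinal lei)) -tnth_nth tnth_mktuple.
Qed.
End Sequences.

Lemma path_of_inj a b (t t' : (2 * a).-tuple {ffun 'I_b -> bool}) :
  (forall i k, i <= 2 * a -> path_of t i k = path_of t' i k) -> t = t'.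
Proof.
move=> e; apply/val_inj/(@eq_from_nth _ [ffun=> false]); rewrite !size_tuple // => i lti.
apply/ffunP => k; have := e i.+1 k lti; rewrite !path_ofS ?size_tuple // e ?(ltnW lti) //.
by do 2!case: ifP => _ //; move=> [] /eqP; rewrite ?(eqn_leq _.+1) ?ltnn ?andbF // eq_sym (eqn_leq _.+1) ltnn.
Qed.

Lemma eq_path_family a b (P P' : nat -> 'I_b -> nat * nat) :
  (forall i k, i <= 2 * a -> P i k = P' i k) -> path_family a P -> path_family a P'.
Proof.
move=> e fam; split=> [k|i k lti|i k lei|i k l lei ltkl|k].
- by rewrite -e // (path_start fam).
- by rewrite -(e i.+1) // -(e i) ?(ltnW lti) //; exact: (path_step fam k lti).
- by rewrite -e //; exact: (path_above fam k lei).
- by rewrite -!e //; exact: (path_lt fam lei ltkl).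
by rewrite -e // (path_end fam).
Qed.

Lemma eq_match_of a b P P' : path_family a P -> path_family a P' ->
  (forall i (k : 'I_b), i <= 2 * a -> P i k = P' i k) ->
  forall p, down_cell a (2 * b) p -> match_of P p = match_of P' p.
Proof.
move=> fam fam' e; apply: above_ind => [p IHp pd|p ltp pd|x _].
- by apply: (can_inj swapK); rewrite -!match_of_swap IHp ?down_swap.
- rewrite !match_of_above //; case: (half_match_cases fam pd ltp).
    move=> [i [k [lti <- ->]]].
    by rewrite (e i.+1 k lti) (e i k (ltnW lti)) (half_match_path fam' k (ltnW lti)).
  move=> [off _ ->]; rewrite (@half_match_off a b P' p) // => i k lei; rewrite -e //; exact: off.
by rewrite !match_of_diag.
Qed.

Lemma eq_tiling_of a c s s' : (forall p, down_cell a c p -> s p = s' p) ->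
  tiling_of a c s = tiling_of a c s'.
Proof.
move=> e; apply/setP => L; apply/tiling_ofP/tiling_ofP => -[t [u [[tD uD ht hu] [eu ->]]]];
  exists t, u; split=> //; split=> //; first by rewrite -e // down_cellE.
by rewrite e // down_cellE.
Qed.

(** [match_of P] sends [P i k] to [P i.+1 k], so the paths are recovered step by step from their
    common starts. *)
Lemma match_of_inj a b P P' : path_family a P -> path_family a P' ->
  (forall p, down_cell a (2 * b) p -> match_of P p = match_of P' p) ->
  forall i (k : 'I_b), i <= 2 * a -> P i k = P' i k.
Proof.
move=> fam fam' e; elim=> [|i IHi] k lei; first by rewrite (path_start fam) (path_start fam').
have {IHi} IHi := IHi k (ltnW lei); have := e _ (path_down fam k lei).
rewrite match_of_above ?(half_match_path fam) ?(path_above fam) ?(ltnW lei) //.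
move=> ->; rewrite IHi match_of_above ?(half_match_path fam') ?(path_above fam') ?(ltnW lei) //.
Qed.

Lemma TC_walks a b : 0 < a ->
  TC a (2 * b) = #|[set t : (2 * a).-tuple {ffun 'I_b -> bool} | walk (packed b) t]|.
Proof.
move=> a_gt0.
pose f (t : (2 * a).-tuple {ffun 'I_b -> bool}) :=
  tiling_of a (2 * b) (match_of (path_of t)).
rewrite -(@card_in_imset _ _ f) /TC; last first.
  move=> t t'; rewrite !inE => /walk_path_family fam /walk_path_family fam' e.
  apply: path_of_inj; apply: match_of_inj => //.
  exact: tiling_of_inj (match_of_matching fam) e.
apply: eq_card => T; rewrite inE; apply/andP/imsetP => [[Tt Ts]|[t]].
  have [s sm ->] := tiling_matching Tt Ts.
  have fam := trace_family a_gt0 sm; have [t et] := exists_path_of fam.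
  have famt : path_family a (path_of t).
    by apply: eq_path_family fam => i k lei; rewrite et.
  exists t; first by rewrite inE; apply/walk_path_family.
  apply: eq_tiling_of => p pd; rewrite (match_of_trace a_gt0 sm) //.
  by apply: eq_match_of pd => // i k lei; rewrite et.
rewrite inE => /walk_path_family fam ->; have sm := match_of_matching fam.
by split; [exact: tiling_of_tiling|exact: tiling_of_symmetric].
Qed.

Local Open Scope ring_scope.

(** * The ballot determinant *)

Fixpoint ballot (t w : nat) {struct t} : nat :=
  match t, w with
  | _, 0 => 0
  | 0, w'.+1 => w' == 0
  | t'.+1, w'.+1 => ballot t' w' + ballot t' w'.+2
  end.

Lemma ballot0 t : ballot t 0 = 0%N.
Proof. by case: t. Qed.

Lemma ballot_step t w :
  (0 < w)%N -> ballot t.+1 w = (ballot t w.-1 + ballot t w.+1)%N.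
Proof. by case: w. Qed.

Lemma ballot_out t w : (t.+1 < w)%N -> ballot t w = 0%N.
Proof.
elim: t w => [|t IHt] [|w] //= hw; first by case: w hw.
by rewrite !IHt //; lia.
Qed.

Lemma ballot_diag t : ballot t t.+1 = 1%N.
Proof. by elim: t => //= t ->; rewrite ballot_out. Qed.

(** The classical ballot formula, cleared of denominators; a walk from [s - r] to [1] has [s - 1]
    steps down and [r] steps up. *)
Lemma ballot_fact t r s : (r + s = t.+1)%N -> (r <= s)%N ->
  (ballot t (s - r) * (s`! * r`!) = t`! * (s - r))%N.
Proof.
elim: t r s => [|t IHt] r s ers ler.
  by have [-> ->] : r = 0%N /\ s = 1%N by lia.
case: (ltngtP r s) ler => // [ltrs|->] _; last by rewrite subnn ballot0 muln0.
rewrite ballot_step ?subn_gt0 //.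
case: s ers ltrs => // s ers ltrs; rewrite ltnS in ltrs.
have IH1 := IHt r s ltac:(lia) ltrs.
have e1 : (s.+1 - r).-1 = (s - r)%N by lia.
rewrite e1 mulnDl factS.
case: r ers ltrs IH1 e1 => [|r] ers ltrs IH1 e1.
  have est : s = t.+1 by lia.
  by rewrite !subn0 est ballot_diag ballot_out // !factS fact0; ring.
have IH2 := IHt r s.+1 ltac:(lia) ltac:(lia).
have e2 : (s.+1 - r.+1).+1 = (s.+1 - r)%N by lia.
rewrite e2.
have -> : (ballot t (s - r.+1) * (s.+1 * s`! * r.+1`!)
           = s.+1 * (ballot t (s - r.+1) * (s`! * r.+1`!)))%N by ring.
have -> : (ballot t (s.+1 - r) * (s.+1 * s`! * r.+1`!)
           = r.+1 * (ballot t (s.+1 - r) * (s.+1`! * r`!)))%N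
  by rewrite !factS; ring.
rewrite IH1 IH2 factS.
have et : t.+1 = (r.+1 + s)%N by lia.
rewrite et.
have [u eu] : exists u, s = (r.+1 + u)%N by exists (s - r.+1)%N; lia.
have -> : (s - r.+1 = u)%N by lia.
have -> : (s.+1 - r = u.+2)%N by lia.
have -> : (s.+1 - r.+1 = u.+1)%N by lia.
rewrite eu; ring.
Qed.

Section WalkDeterminant.
Variable b : nat.
Implicit Types (w : {ffun 'I_b -> nat}) (e : {ffun 'I_b -> bool}).

(** [ballot n h] counts the walks of length [n] from [h] to [1] avoiding [0]; the
    columns are extended by [2 j] extra steps so that the matrix is unitriangular
    for [n = 0] and [w = packed b]. *)
Definition ballot_det n w : rat :=
  \det (\matrix_(k < b, j < b) (ballot (n + 2 * j) (w k))%:R).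

(** Multilinearity in the rows. A choice [f] of one summand per row will be a simultaneous step of
    all walkers. *)
Lemma det_sum (X : finType) (F : X -> 'I_b -> 'I_b -> rat) :
  \det (\matrix_(k, j) \sum_x F x k j) =
  \sum_(f : {ffun 'I_b -> X}) \det (\matrix_(k, j) F (f k) k j).
Proof.
rewrite /determinant exchange_big /=; apply: eq_bigr => s _.
rewrite -mulr_sumr; congr (_ * _).
under eq_bigr do rewrite mxE.
rewrite bigA_distr_bigA /=; apply: eq_bigr => f _.
by apply: eq_bigr => k _; rewrite mxE.
Qed.

Lemma ballot_detS n w : (forall k, 0 < w k)%N ->
  ballot_det n.+1 w = \sum_e ballot_det n (stride w e).
Proof.
move=> w_gt0; rewrite /ballot_det.
pose F (x : bool) (k j : 'I_b) : rat :=
  (ballot (n + 2 * j) (if x then (w k).-1 else (w k).+1))%:R.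
transitivity (\det (\matrix_(k < b, j < b) \sum_x F x k j)).
  congr (\det _); apply/matrixP => k j; rewrite !mxE.
  by rewrite addSn ballot_step // natrD big_bool.
rewrite det_sum; apply: eq_bigr => e _; congr (\det _).
by apply/matrixP => k j; rewrite !mxE ffunE.
Qed.

(** Equal parity widens the gap from one to two, so a single step can make walkers meet but not
    cross. *)
Lemma admissible_gap w (k l : 'I_b) : (forall k l, odd (w k) = odd (w l)) ->
  admissible w -> (k < l)%N -> ((w k).+2 <= w l)%N.
Proof.
move=> wpar /admissibleP[_ wlt] /wlt; have := wpar k l; lia.
Qed.

Lemma admissible_ge w (k : 'I_b) : (forall k l, odd (w k) = odd (w l)) ->
  admissible w -> ((2 * k).+1 <= w k)%N.
Proof.
move=> wpar wad; case: k => k; elim: k => [|k IHk] ltkb.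
  by have /admissibleP[/(_ (Ordinal ltkb))] := wad.
have := IHk (ltnW ltkb).
have := @admissible_gap w (Ordinal (ltnW ltkb)) (Ordinal ltkb) wpar wad (leqnn _).
rewrite /=; lia.
Qed.

Lemma packed_odd (k l : 'I_b) : odd (packed b k) = odd (packed b l).
Proof. by rewrite !ffunE /= !oddM. Qed.

Lemma packed_admissible : admissible (packed b).
Proof. by apply/admissibleP; split=> [k|k l]; rewrite !ffunE //; lia. Qed.

(** A walker on the axis gives a zero row, and two walkers that meet give equal rows. *)
Lemma ballot_det_zero n w : ~~ admissible w -> (forall k l : 'I_b, k < l -> w k <= w l)%N ->
  ballot_det n w = 0.
Proof.
move=> wnad wle; rewrite /ballot_det.
have [/forallP w0|/forallPn[k]] := boolP [forall k, 0 < w k]%N; last first.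
  rewrite -eqn0Ngt => /eqP wk0; rewrite (expand_det_row _ k) big1 // => j _.
  by rewrite mxE wk0 ballot0 mul0r.
move: wnad; rewrite /admissible negb_and.
have -> /= : [forall k, 0 < w k]%N by apply/forallP.
move=> /forallPn[k /forallPn[l]]; rewrite negb_imply -leqNgt => /andP[ltkl lewlk].
have ewkl : w k = w l by apply/eqP; rewrite eqn_leq wle.
apply: (@determinant_alternate _ _ _ k l); first by rewrite neq_ltn ltkl.
by move=> j; rewrite !mxE ewkl.
Qed.

(** At the packed position the matrix is unitriangular. At any other admissible position of constant
    parity the last walker is beyond [2b-1], too far for every column, so its row is zero. *)
Lemma ballot_det_initial w : (forall k l, odd (w k) = odd (w l)) ->
  admissible w -> ballot_det 0 w = (w == packed b)%:R.
Proof.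
move=> wpar wad; have wge := fun k => admissible_ge k wpar wad.
have [->|wnp] := eqVneq w (packed b).
  rewrite /ballot_det -det_tr det_trig.
    by rewrite big1 // => k _; rewrite !mxE ffunE ballot_diag.
  apply/is_trig_mxP => k j ltkj; rewrite !mxE ffunE.
  by rewrite ballot_out //; lia.
have [k wk] : exists k : 'I_b, (2 * k).+1 != w k.
  apply/existsP; apply: contraR wnp => /existsPn wk.
  by apply/eqP/ffunP => k; rewrite ffunE; apply/esym/eqP; rewrite -[_ == _]negbK wk.
have wk_gt : ((2 * k).+1 < w k)%N by rewrite ltn_neqAle wk wge.
have lt_last : (b.-1 < b)%N by have := ltn_ord k; lia.
have wl_gt : ((2 * b.-1).+1 < w (Ordinal lt_last))%N.
  have [ekl|lekl] := eqVneq (k : nat) b.-1.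
    have -> : Ordinal lt_last = k by apply: val_inj.
    by lia.
  (* The gap of two passes the excess over the packed position on to the next walker, up to the
     last; the induction bounds the distance to it. *)
  elim: {k wk} _.+1 {-2}k (ltnSn (b.-1 - k)) wk_gt lekl => // m IHm k lem wk_gt nek.
  have ltk : (k.+1 < b)%N by have := ltn_ord k; lia.
  have := @admissible_gap w k (Ordinal ltk) wpar wad (leqnn _).
  have [ekl|lekl] := eqVneq k.+1 b.-1.
    have -> : Ordinal ltk = Ordinal lt_last by apply: val_inj.
    by move=> gap; lia.
  by move=> gap; apply: (IHm (Ordinal ltk)) => //=; lia.
rewrite /ballot_det (expand_det_row _ (Ordinal lt_last)) big1 // => j _.
by rewrite mxE ballot_out ?mul0r //; have := ltn_ord j; lia.
Qed.

Lemma stride_odd w e : (forall k, 0 < w k)%N -> (forall k l, odd (w k) = odd (w l)) ->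
  forall k l, odd (stride w e k) = odd (stride w e l).
Proof.
move=> w0 wpar; suff par k : odd (stride w e k) = ~~ odd (w k).
  by move=> k l; rewrite !par (wpar k l).
by rewrite ffunE; have := w0 k; case: (w k) => // m _; case: (e k); rewrite /= ?negbK.
Qed.

Lemma stride_le w e (k l : 'I_b) : (forall k l, odd (w k) = odd (w l)) ->
  admissible w -> (k < l)%N -> (stride w e k <= stride w e l)%N.
Proof.
move=> wpar wad /(admissible_gap wpar wad); rewrite !ffunE.
by case: (e k) (e l) => [] []; lia.
Qed.

Lemma card_tuple_cons (T : finType) n (P : pred (seq T)) :
  #|[set t : n.+1.-tuple T | P t]| = (\sum_x #|[set t : n.-tuple T | P (x :: t)]|)%N.
Proof.
under eq_bigr do rewrite -sum1_card big_mkcond.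
rewrite pair_big -sum1_card big_mkcond /=.
rewrite (reindex (fun p : T * n.-tuple T => [tuple of p.1 :: p.2])) /=.
  by apply: eq_bigr => p _; rewrite !inE.
exists (fun t => (thead t, [tuple of behead t])) => [[x t] _|t _] /=.
  by congr pair; apply: val_inj.
by rewrite -tuple_eta.
Qed.

(** Both sides expand over the first step; a stride to a position that is not admissible contributes
    no walk and a vanishing determinant. *)
Lemma card_walks n w : (forall k l, odd (w k) = odd (w l)) -> admissible w ->
  (#|[set t : n.-tuple {ffun 'I_b -> bool} | walk w t]|)%:R = ballot_det n w.
Proof.
elim: n w => [|n IHn] w wpar wad.
  rewrite ballot_det_initial //; congr _%:R.
  have [ew|nw] := boolP (w == packed b).
    by rewrite (_ : [set t | _] = setT) ?cardsT ?card_tuple //; apply/setP => t; rewrite !inE tuple0 /= ew wad.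
  by apply/eqP; rewrite cards_eq0; apply/eqP/setP => t; rewrite !inE tuple0 /= (negPf nw) andbF.
have [w0 wlt] := admissibleP _ wad.
rewrite card_tuple_cons natr_sum ballot_detS //; apply: eq_bigr => e _.
have [ad|nad] := boolP (admissible (stride w e)).
  rewrite -IHn //; last exact: stride_odd.
  by congr (_%:R); apply: eq_card => t; rewrite !inE /= wad.
rewrite ballot_det_zero //; last by move=> k l; apply: stride_le.
rewrite (_ : [set t | _] = set0) ?cards0 //; apply/setP => t; rewrite !inE /= wad /=.
by case: (tval t) => [|? ?] /=; rewrite (negPf nad).
Qed.
End WalkDeterminant.

(** * Product formula *)

Lemma fact_rat_neq0 n : n`!%:R != 0 :> rat.
Proof. by rewrite pnatr_eq0 -lt0n fact_gt0. Qed.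

Lemma det_scale n (r c : 'I_n -> rat) (M : 'I_n -> 'I_n -> rat) :
  \det (\matrix_(i, j) (r i * M i j * c j)) =
  (\prod_i r i) * \det (\matrix_(i, j) M i j) * (\prod_j c j).
Proof.
have -> : \matrix_(i, j) (r i * M i j * c j) =
    diag_mx (\row_i r i) *m (\matrix_(i, j) M i j) *m diag_mx (\row_j c j).
  by apply/matrixP => i j; rewrite mul_mx_diag mul_diag_mx !mxE.
rewrite !det_mulmx !det_diag.
by congr (_ * _ * _); apply: eq_bigr => i _; rewrite mxE.
Qed.

(** The matrix is a Vandermonde matrix times the coefficient matrix, which is unitriangular because
    the polynomials are monic with degrees falling from [n-1] to [0]. *)
Lemma det_monic_poly n (p : 'I_n -> {poly rat}) (x : 'I_n -> rat) :
  (forall j, p j \is monic) -> (forall j, size (p j) = (rev_ord j).+1) ->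
  \det (\matrix_(k, j) (p j).[x k]) = \det (\matrix_(k, j) x k ^+ rev_ord j).
Proof.
move=> pmonic psize.
have -> : \matrix_(k, j) (p j).[x k] =
    (\matrix_(k < n, m < n) x k ^+ rev_ord m) *m (\matrix_(m < n, j < n) (p j)`_(rev_ord m)).
  apply/matrixP => k j; rewrite !mxE (@horner_coef_wide _ n); last first.
    by rewrite psize ltn_ord.
  rewrite (reindex_inj rev_ord_inj); apply: eq_bigr => m _.
  by rewrite !mxE mulrC.
rewrite det_mulmx [X in _ * X]det_trig ?big1 ?mulr1 //.
  by move=> j _; rewrite mxE -[X in _`_X]/(_.+1.-1) -psize -/(lead_coef _) (monicP _).
apply/is_trig_mxP => m j ltmj; rewrite mxE nth_default // psize /=.
by have := ltn_ord j; lia.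
Qed.

(** Since [l(l+1) - k(k+1) = (l-k)(l+k+1)], the product is a quotient of factorials. *)
Lemma prod_oblong_fact (k m n : nat) : (k < m)%N -> (m <= n)%N ->
  \prod_(m <= l < n) (l%:R * l.+1%:R - k%:R * k.+1%:R) *
    ((m + k)`! * (m.-1 - k)`!)%:R = ((n + k)`! * (n.-1 - k)`!)%:R :> rat.
Proof.
move=> ltkm; elim: n => [|n IHn]; first by lia.
rewrite leq_eqVlt => /predU1P[->|]; first by rewrite big_geq ?mul1r.
rewrite ltnS => lemn; rewrite big_nat_recr //= mulrAC IHn //.
have [d ->] : exists d, n = (k + d.+1)%N by exists (n - k.+1)%N; lia.
rewrite (_ : (k + d.+1).-1 - k = d)%N; last by lia.
rewrite (_ : (k + d.+1) - k = d.+1)%N; last by lia.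
rewrite addSn !factS !(natrM, natrD, =^~ natr1); ring.
Qed.

(** The factorials [(a+j+1+k)!] and [(a+j-k)!] of the ballot formula are completed to [(a+b+k)!] and
    [(a+b-1-k)!], free of [j]; what is left is a polynomial of degree [b-1-j] in [k(k+1)]. *)
Lemma ballot_entry (a b : nat) (k j : 'I_b) :
  (ballot (2 * a + 2 * j) (2 * k).+1)%:R =
  (2 * k).+1%:R / ((a + b + k)`! * (a + rev_ord k)`!)%:R *
  \prod_((a + j).+1 <= l < a + b) (l%:R * l.+1%:R - k%:R * k.+1%:R) *
  (2 * (a + j))`!%:R :> rat.
Proof.
have ltk := ltn_ord k; have ltj := ltn_ord j.
case: (leqP k (a + j)) => [lekj|ltjk]; last first.
  (* Here the walk is too short to reach [1], and the factor [l = k] of the product vanishes. *)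
  rewrite ballot_out; last by lia.
  rewrite [X in _ * X * _](_ : _ = 0) ?(mulr0, mul0r) //.
  apply/eqP; rewrite prodf_seq_eq0; apply/hasP; exists (k : nat); rewrite ?subrr //.
  by rewrite mem_index_iota; lia.
have := @ballot_fact (2 * a + 2 * j) (a + j - k) ((a + j).+1 + k) ltac:(lia) ltac:(lia).
have -> : ((a + j).+1 + k - (a + j - k) = (2 * k).+1)%N by lia.
have := @prod_oblong_fact k (a + j).+1 (a + b) ltac:(lia) ltac:(lia).
rewrite /= (_ : (a + b).-1 - k = a + (b - k.+1))%N; last by lia.
rewrite -mulnDr; set F := ((_`! * _)%N); set G := ((_`! * _)%N).
set P := \prod_(_ <= l < _) _ => eP /(congr1 (fun n => n%:R : rat)).
have F0 : F%:R != 0 :> rat by rewrite pnatr_eq0 muln_eq0 negb_or -!lt0n !fact_gt0.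
have G0 : G%:R != 0 :> rat by rewrite pnatr_eq0 muln_eq0 negb_or -!lt0n !fact_gt0.
rewrite !(natrM _ _ F) natrM => eB; apply: (mulIf F0); rewrite eB.
by rewrite mulrAC -[_ * P * _]mulrA eP divfK // mulrC.
Qed.

Definition det_factor (a b : nat) : rat :=
  (\prod_(k < b) ((2 * k).+1%:R / ((a + b + k)`! * (a + rev_ord k)`!)%:R)) *
  \prod_(j < b) (2 * (a + j))`!%:R.

Lemma ballot_det_packed (a b : nat) :
  ballot_det (2 * a) (packed b) = det_factor a b *
   \det (\matrix_(k < b, j < b) (- (k%:R * k.+1%:R)) ^+ rev_ord j).
Proof.
rewrite /ballot_det /det_factor.
under [in LHS]eq_mx => k j do rewrite ffunE ballot_entry.
rewrite (det_scale _ _ (fun k j : 'I_b => \prod_((a + j).+1 <= l < a + b) (l%:R * l.+1%:R - k%:R * k.+1%:R))).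
rewrite mulrAC; congr (_ * _).
(* Evaluation is at [-k(k+1)] rather than [k(k+1)] so that these polynomials are monic. *)
pose p (j : 'I_b) : {poly rat} :=
  \prod_((a + j).+1 <= l < a + b) ('X - (- (l%:R * l.+1%:R))%:P).
rewrite -(@det_monic_poly _ p).
- congr (\det _); apply/matrixP => k j; rewrite !mxE /p horner_prod.
  by apply: eq_bigr => l _; rewrite !hornerE opprK addrC.
- by move=> j; rewrite monic_prod_XsubC.
- move=> j; rewrite size_prod_XsubC size_iota /=; lia.
Qed.

Lemma prod_shift (f : nat -> rat) (a b : nat) :
  (\prod_(k < b) f (a.+1 + k)%N) * f a = (\prod_(k < b) f (a + k)%N) * f (a + b)%N.
Proof.
transitivity (\prod_(k < b.+1) f (a + k)%N); last by rewrite big_ord_recr.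
rewrite big_ord_recl mulrC addn0; congr (_ * _).
by apply: eq_bigr => k _; rewrite /= /bump addSnnS.
Qed.

(** Three of the products run over [b] consecutive arguments; shifting such a window by one only
    exchanges its end factors, by [prod_shift]. *)
Lemma det_factorS a b : det_factor a.+1 b =
  det_factor a b * ((2 * a + 2 * b)`!%:R * a`!%:R / ((2 * a)`!%:R * (a + 2 * b)`!%:R)).
Proof.
have vE n : det_factor n b = (\prod_(k < b) (2 * k).+1%:R) *
    (\prod_(k < b) (2 * (n + k))`!%:R) /
    ((\prod_(k < b) (n + b + k)`!%:R) * (\prod_(k < b) (n + k)`!%:R)).
  rewrite /det_factor big_split /= mulrAC; congr (_ * _).
  rewrite prodfV; congr (_^-1).
  under eq_bigr do rewrite natrM.
  rewrite big_split /=; congr (_ * _).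
  rewrite (reindex_inj rev_ord_inj); apply: eq_bigr => k _.
  by congr (_`!%:R); rewrite /=; have := ltn_ord k; lia.
have s1 := prod_shift (fun n => (2 * n)`!%:R) a b.
have s2 := prod_shift (fun n => n`!%:R) (a + b) b.
have s3 := prod_shift (fun n => n`!%:R) a b.
rewrite !vE.
have nz (g : nat -> nat) : \prod_(k < b) (g k)`!%:R != 0 :> rat.
  by apply/prodf_neq0 => k _; apply: fact_rat_neq0.
have n1 := nz (fun k => a + b + k)%N; have n2 := nz (fun k => a + k)%N.
have {nz} quot (x y u v : rat) : v != 0 -> x * v = y * u -> x = y * u / v.
  by move=> v0 <-; rewrite mulfK.
have f0 := fact_rat_neq0.
rewrite (quot _ _ _ _ (f0 _) s1) (quot _ _ _ _ (f0 _) s2) (quot _ _ _ _ (f0 _) s3).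
rewrite -mulnDr (_ : a + 2 * b = a + b + b)%N; last by lia.
by field; rewrite !f0 n1 n2.
Qed.

Lemma det_ballot_packed0 b : ballot_det 0 (packed b) = 1.
Proof.
by rewrite ballot_det_initial ?eqxx //; [exact: packed_odd|exact: packed_admissible].
Qed.

(** The Vandermonde determinant is a common factor of both sides and is never evaluated;
    [det_ballot_packed0] supplies the initial value. *)
Lemma ballot_det_packedS a b : ballot_det (2 * a.+1) (packed b) =
  ballot_det (2 * a) (packed b) *
  ((2 * a + 2 * b)`!%:R * a`!%:R / ((2 * a)`!%:R * (a + 2 * b)`!%:R)).
Proof. by rewrite !ballot_det_packed det_factorS mulrAC. Qed.

(** * Recursion for the product side *)

(** Passing from [a] to [a+1] raises the exponent [minn j (a - j)] by one exactly when [2j > a]. *)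
Lemma prod_min_step (r : nat -> rat) a :
  \prod_(1 <= j < a.+1) r j ^+ minn j (a.+1 - j) =
  \prod_(1 <= j < a) r j ^+ minn j (a - j) * \prod_(1 <= j < a.+1 | (a < 2 * j)%N) r j.
Proof.
case: a => [|a]; first by rewrite !big_geq.
have -> : \prod_(1 <= j < a.+1) r j ^+ minn j (a.+1 - j) =
    \prod_(1 <= j < a.+2) r j ^+ minn j (a.+1 - j).
  by rewrite [RHS]big_nat_recr //= subnn minn0 mulr1.
rewrite [X in _ = _ * X]big_mkcond -big_split /=.
apply: eq_big_nat => j hj; case: ifP => hlt.
  by rewrite -exprSr; congr (_ ^+ _); lia.
by rewrite mulr1; congr (_ ^+ _); lia.
Qed.

Lemma prod_parity_split (r : nat -> rat) a : (0 < a)%N ->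
  \prod_(1 <= j < a.+1 | (a < 2 * j)%N) r (2 * j)%N *
  \prod_(1 <= j < a | (a.-1 < 2 * j)%N) r (2 * j).+1 = \prod_(a.+1 <= s < (2 * a).+1) r s.
Proof.
(* Extending [r] by [1] outside the range lets all products run over one initial segment, whose even
   and odd indices pair up. *)
move=> a0; pose f s : rat := if (a < s <= 2 * a)%N then r s else 1.
have par n : \prod_(0 <= s < 2 * n) f s = \prod_(0 <= j < n) (f (2 * j)%N * f (2 * j).+1).
  elim: n => [|n IHn]; first by rewrite !big_geq.
  by rewrite mulnS !big_nat_recr //= IHn mulrA.
transitivity (\prod_(0 <= s < 2 * a.+1) f s).
  rewrite par big_split /=; congr (_ * _).
    rewrite (big_nat_widenl _ 0) // big_mkcond; apply: eq_big_nat => j hj.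
    by rewrite /f; congr (if _ then _ else _); lia.
  rewrite (big_nat_widenl _ 0) // (big_nat_widen _ _ a.+1) // big_mkcond.
  apply: eq_big_nat => j hj; rewrite /f; congr (if _ then _ else _); lia.
rewrite [RHS](big_nat_widenl _ 0) // [RHS](big_nat_widen _ _ (2 * a.+1)); last by lia.
rewrite [RHS]big_mkcond; apply: eq_big_nat => j hj; rewrite /f.
by congr (if _ then _ else _); lia.
Qed.

Lemma prod_fact_ratio m n k : (m <= n)%N ->
  \prod_(m.+1 <= s < n.+1) ((k + s)%:R / s%:R) =
  (k + n)`!%:R * m`!%:R / (n`!%:R * (k + m)`!%:R) :> rat.
Proof.
have f0 := fact_rat_neq0.
elim: n => [|n IHn]; rewrite ?leqn0.
  by move/eqP->; rewrite big_geq // [X in _ / X]mulrC divff // mulf_neq0.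
rewrite leq_eqVlt => /predU1P[->|].
  by rewrite big_geq // [X in _ / X]mulrC divff // mulf_neq0.
rewrite ltnS => lemn; rewrite big_nat_recr //= IHn // addnS !factS !natrM.
by field; rewrite !f0 ?nat1r ?natr1 ?pnatr_eq0.
Qed.

(** Writing [(b+j)/j] as [(2b+2j)/(2j)] makes both products evaluate the same function [(2b+s)/s],
    at even and at odd [s]. *)
Definition tc_product (a b : nat) : rat :=
  \prod_(1 <= j < a) ((2 * b + 2 * j)%:R / (2 * j)%:R) ^+ minn j (a - j) *
  \prod_(1 <= j < a.-1) ((2 * b + (2 * j).+1)%:R / (2 * j).+1%:R) ^+ minn j (a.-1 - j).

(** The new even and odd factors together are [(2b+s)/s] for [a < s <= 2a], once each, and their
    product is a quotient of factorials. *)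
Lemma tc_productS a b : (0 < a)%N -> tc_product a.+1 b =
  tc_product a b *
  ((2 * a + 2 * b)`!%:R * a`!%:R / ((2 * a)`!%:R * (a + 2 * b)`!%:R)).
Proof.
case: a => // a _; rewrite /tc_product /=.
rewrite prod_min_step [X in _ * X = _]prod_min_step mulrACA.
rewrite (prod_parity_split (fun s => (2 * b + s)%:R / s%:R)) // prod_fact_ratio; last by lia.
by rewrite ![(2 * b + _)%N]addnC.
Qed.

Lemma ballot_det_packed_product a b : (0 < a)%N ->
  ballot_det (2 * a) (packed b) = tc_product a b.
Proof.
case: a => // a _; elim: a => [|a IHa]; last by rewrite ballot_det_packedS IHa (@tc_productS a.+1).
(* The induction starts at [a = 1], where the products are empty and the factorial ratio taken at
   [0] equals [1]. *)
rewrite ballot_det_packedS det_ballot_packed0 /tc_product !big_geq // mul1r.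
by rewrite muln0 !add0n fact0 !mulr1 mul1r divff ?fact_rat_neq0.
Qed.

Lemma tc_productE a b : tc_product a b =
    ((\prod_(1 <= j < a) (b + j)%:R ^+ minn j (a - j)) *
     (\prod_(1 <= j < a - 1) (2 * b + 2 * j + 1)%:R ^+ minn j (a - 1 - j)))
    / ((\prod_(1 <= j < a) j%:R ^+ minn j (a - j)) *
       (\prod_(1 <= j < a - 1) (2 * j + 1)%:R ^+ minn j (a - 1 - j))).
Proof.
rewrite -mulf_div -!prodf_div subn1 /tc_product; congr (_ * _).
  apply: eq_bigr => j _; rewrite -expr_div_n -mulnDr !natrM -mulf_div divff ?mul1r //.
by apply: eq_bigr => j _; rewrite -expr_div_n -addnA addn1.
Qed.

Theorem theorem6p1 (a b : nat) (ha : (1 <= a)%N) (hb : (1 <= b)%N) :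
  (TC a (2 * b))%:R =
    ((\prod_(1 <= j < a) (b + j)%:R ^+ minn j (a - j)) *
     (\prod_(1 <= j < a - 1) (2 * b + 2 * j + 1)%:R ^+ minn j (a - 1 - j)))
    / ((\prod_(1 <= j < a) j%:R ^+ minn j (a - j)) *
       (\prod_(1 <= j < a - 1) (2 * j + 1)%:R ^+ minn j (a - 1 - j))) :> rat.
Proof.
rewrite -tc_productE -ballot_det_packed_product // TC_walks // card_walks //.
  exact: packed_odd.
exact: packed_admissible.
Qed.
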